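(* Let $r,s>0$ be odd integers with $r\ne s$. Then the Spin block pair $$\bigl(\mathrm{Spin}_{r+s},\ \mathrm{Spin}_r\times_{\mu_2}\mathrm{Spin}_s\bigr)$$ is pleasant.
   Context: All groups are over $\mathbb C$. Let $U,W$ be nondegenerate complex quadratic spaces of dimensions $r,s$, $E=U\oplus W$ (orthogonal sum), $G=\mathrm{Spin}(E)$, and let $\theta$ be the involution of $G$ induced by the isometry $1_U\oplus(-1_W)$ of $E$. The fixed subgroup is $H=G^\theta=\mathrm{Spin}(U)\times_{\mu_2}\mathrm{Spin}(W)$, with the convention $\mathrm{Spin}_1=\mu_2$. This is the Spin block pair. For a symmetric pair $(G,H,\theta)$ put $A_\theta=\{g\in G:\theta(g)\in gZ(G)\}$. The pair is called pleasant if $A_\theta\subset HZ(G)$. *)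

(* Defs.v *)
From HB Require Import structures.
From mathcomp Require Import all_boot all_order all_algebra sesquilinear.
From mathcomp Require Import boolp classical_sets reals complex.

Set Implicit Arguments.
Unset Strict Implicit.
Unset Printing Implicit Defensive.

Import Order.TTheory GRing.Theory Num.Theory.
Local Open Scope ring_scope.
Local Open Scope quotient_scope.

Section SymmetricPair.
Local Open Scope group_scope.
Variables (G : groupType) (theta : G -> G).

Definition group_center : set G := [set z | forall g : G, commute z g].

Definition fixed_subgroup : set G := [set g | theta g = g].

Definition A_theta : set G :=
  [set g | exists2 z, group_center z & theta g = g * z].

Definition pleasant (H : set G) : Prop :=
  forall g, A_theta g ->
    exists h z, [/\ H h, group_center z & g = h * z].

End SymmetricPair.

(* The Clifford algebra of a symmetric bilinear form B, with the convention   *)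
(* v ^+ 2 = B v v.  It is presented by generators and relations: formal       *)
(* polynomial expressions in the elements of V, modulo the smallest           *)
(* congruence making them an associative unital K-algebra in which the        *)
(* generators depend linearly on v and satisfy the Clifford relation.         *)
Section CliffordTerms.
Variables (K : numFieldType) (V : vectType K).

Inductive cterm : Type :=
  | CGen of V
  | CCst of K
  | CAdd of cterm & cterm
  | CMul of cterm & cterm.

HB.instance Definition _ := gen_eqMixin cterm.
HB.instance Definition _ := gen_choiceMixin cterm.

Variable B : {symmetric V}.

Inductive ceq : cterm -> cterm -> Prop :=
  | ceq_refl x : ceq x x
  | ceq_sym x y : ceq x y -> ceq y x
  | ceq_trans x y z : ceq x y -> ceq y z -> ceq x z
  | ceq_add x x' y y' : ceq x x' -> ceq y y' -> ceq (CAdd x y) (CAdd x' y')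
  | ceq_mul x x' y y' : ceq x x' -> ceq y y' -> ceq (CMul x y) (CMul x' y')
  | ceq_addA x y z : ceq (CAdd x (CAdd y z)) (CAdd (CAdd x y) z)
  | ceq_addC x y : ceq (CAdd x y) (CAdd y x)
  | ceq_add0 x : ceq (CAdd (CCst 0) x) x
  | ceq_mulA x y z : ceq (CMul x (CMul y z)) (CMul (CMul x y) z)
  | ceq_mulDl x y z : ceq (CMul (CAdd x y) z) (CAdd (CMul x z) (CMul y z))
  | ceq_mulDr x y z : ceq (CMul x (CAdd y z)) (CAdd (CMul x y) (CMul x z))
  | ceq_mul0 x : ceq (CMul (CCst 0) x) (CCst 0)
  | ceq_mul1 x : ceq (CMul (CCst 1) x) x
  | ceq_cstC a x : ceq (CMul (CCst a) x) (CMul x (CCst a))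
  | ceq_cstD a b : ceq (CCst (a + b)) (CAdd (CCst a) (CCst b))
  | ceq_cstM a b : ceq (CCst (a * b)) (CMul (CCst a) (CCst b))
  | ceq_genP a v w :
      ceq (CGen (a *: v + w)) (CAdd (CMul (CCst a) (CGen v)) (CGen w))
  | ceq_gen_sqr v : ceq (CMul (CGen v) (CGen v)) (CCst (B v v)).

Definition ceqb (x y : cterm) : bool := `[< ceq x y >].

Lemma ceqb_equiv : equiv_class_of ceqb.
Proof.
split.
- by move=> x; apply/asboolP; apply: ceq_refl.
- by move=> x y; apply/asboolP/asboolP; apply: ceq_sym.
- move=> y x z /asboolP xy /asboolP yz; apply/asboolP.
  exact: ceq_trans xy yz.
Qed.

Canonical ceqb_equivRel := EquivRelPack ceqb_equiv.

Section Eval.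
Variables (A : algType K) (f : {linear V -> A}).
Hypothesis f_sqr : forall v, f v * f v = (B v v)%:A.

Fixpoint ceval (x : cterm) : A :=
  match x with
  | CGen v => f v
  | CCst a => a%:A
  | CAdd x y => ceval x + ceval y
  | CMul x y => ceval x * ceval y
  end.

Lemma ceval_ceq x y : ceq x y -> ceval x = ceval y.
Proof.
elim=> //=.
- by move=> {}x {}y z _ -> _ ->.
- by move=> {}x x' {}y y' _ -> _ ->.
- by move=> {}x x' {}y y' _ -> _ ->.
- by move=> *; rewrite addrA.
- by move=> *; rewrite addrC.
- by move=> *; rewrite scale0r add0r.
- by move=> *; rewrite mulrA.
- by move=> *; rewrite mulrDl.
- by move=> *; rewrite mulrDr.
- by move=> *; rewrite scale0r mul0r.
- by move=> *; rewrite scale1r mul1r.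
- by move=> *; rewrite mulr_algl mulr_algr.
- by move=> *; rewrite scalerDl.
- by move=> *; rewrite mulr_algl scalerA.
- by move=> *; rewrite mulr_algl linearP.
Qed.

End Eval.

(* The matrices are those of left multiplication on Cl' (+) e Cl', where Cl'  *)
(* is the Clifford algebra of the previous step and e the new generator:      *)
(* v e = - e v + 2 B(v, e).  They show that the Clifford algebra is nonzero.  *)
Lemma clifford_matrices (n : nat) (g : nat -> nat -> K) :
  exists p (M : nat -> 'M[K]_p), [/\ (0 < p)%N,
    forall i, (i < n)%N -> M i *m M i = (g i i)%:M &
    forall i j, (i < j < n)%N ->
      M i *m M j + M j *m M i = (g i j *+ 2)%:M].
Proof.
elim: n => [|n [p [M [p0 Msq Mac]]]].
  by exists 1, (fun _ => 0); split=> // i j /andP[].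
pose L i : 'M[K]_(p + p) := block_mx (M i) ((g i n *+ 2)%:M) 0 (- M i).
pose e : 'M[K]_(p + p) := block_mx 0 ((g n n)%:M) 1%:M 0.
exists (p + p)%N, (fun i => if (i < n)%N then L i else e); split.
- by rewrite addn_gt0 p0.
- move=> i; rewrite ltnS leq_eqVlt => /predU1P[->|ltin].
    rewrite ltnn /e mulmx_block scalar_mx_block.
    by rewrite !mul0mx !mulmx0 !mulmx1 !mul1mx !add0r !addr0.
  rewrite ltin /L mulmx_block scalar_mx_block.
  rewrite !mul0mx !mulmx0 !addr0 !add0r mulNmx !mulmxN opprK Msq //.
  by rewrite scalar_mxC subrr.
move=> i j /andP[ltij]; rewrite ltnS leq_eqVlt => /predU1P[eqj|ltjn].
  rewrite {j}eqj in ltij *; rewrite ltij ltnn /L /e !mulmx_block.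
  rewrite add_block_mx scalar_mx_block.
  rewrite !mul0mx !mulmx0 !mulmx1 !mul1mx !addr0 !add0r.
  by rewrite mulmxN scalar_mxC subrr addNr.
rewrite ltjn (ltn_trans ltij ltjn) /L !mulmx_block add_block_mx.
rewrite scalar_mx_block !mul0mx !mulmx0 !addr0 !add0r !mulNmx !mulmxN !opprK.
rewrite Mac ?ltij // !scalar_mxC.
by rewrite addrA subrK subrr.
Qed.

Lemma clifford_map_exists :
  exists N (f : {linear V -> 'M[K]_N.+1}), forall v, f v * f v = (B v v)%:A.
Proof.
pose e := vbasis {:V}.
have [[|N] [M []]// _ Msq Mac] :=
  clifford_matrices (\dim {:V}) (fun i j => B e`_i e`_j).
pose f v : 'M[K]_N.+1 := \sum_(i < \dim {:V}) coord e i v *: M i.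
have f_lin : linear f.
  move=> a u v; rewrite /f scaler_sumr -big_split; apply: eq_bigr => i _ /=.
  by rewrite linearP scalerDl scalerA.
exists N, (HB.pack_for {linear V -> 'M[K]_N.+1} f
             (GRing.isLinear.Build _ _ _ _ f f_lin)) => v /=.
have Mac2 (i j : 'I_(\dim {:V})) :
    M i * M j + M j * M i = (B e`_i e`_j *+ 2)%:A.
  transitivity ((B e`_i e`_j *+ 2)%:M : 'M[K]_N.+1); last first.
    by symmetry; apply: scalemx1.
  have [ij|ji|/val_inj ->] := ltngtP i j.
  - by rewrite [LHS]Mac ?ij ?ltn_ord.
  - rewrite addrC [LHS]Mac ?ji ?ltn_ord //; congr (_ *+ 2)%:M.
    by rewrite (@hermitian_subproof _ _ _ _ B) expr0 mul1r.
  - by rewrite [_ * _]Msq // -mulr2n raddfMn.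
have two_neq0 : 2%:R != 0 :> K by rewrite pnatr_eq0.
apply: (scalerI two_neq0); rewrite !scaler_nat mulr2n.
have -> : f v * f v + f v * f v =
    \sum_(i < \dim {:V}) \sum_(j < \dim {:V})
      (coord e i v * coord e j v) *: (M i * M j + M j * M i).
  have ff : f v * f v = \sum_(i < \dim {:V}) \sum_(j < \dim {:V})
      (coord e i v * coord e j v) *: (M i * M j).
    rewrite /f mulr_suml; apply: eq_bigr => i _.
    rewrite mulr_sumr; apply: eq_bigr => j _.
    by rewrite -scalerAl -scalerAr scalerA.
  rewrite {2}ff exchange_big ff -big_split; apply: eq_bigr => i _ /=.
  rewrite -big_split; apply: eq_bigr => j _ /=.
  by rewrite [coord e j v * _]mulrC scalerDr.
rewrite {3 4}(coord_vbasis (memvf v)) -/e.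
under eq_bigr do under eq_bigr do rewrite Mac2 scalerA.
rewrite scalerMnl linear_sumlz -sumrMnl scaler_suml; apply: eq_bigr => i _.
rewrite linearZl_LR raddf_sum /= mulr_sumr -sumrMnl scaler_suml.
apply: eq_bigr => j _; congr (_ *: _).
by rewrite linearZr_LR /= mulrnAr mulrA.
Qed.

Definition clifford : Type := {eq_quot ceqb}.
HB.instance Definition _ := Choice.on clifford.
HB.instance Definition _ := Quotient.on clifford.

Definition cpi (x : cterm) : clifford := \pi_clifford x.

Lemma cpiP x y : cpi x = cpi y <-> ceq x y.
Proof.
rewrite /cpi; split=> [/eqquotP/asboolP //|xy].
by apply/eqquotP/asboolP.
Qed.

Lemma cpiK (x : clifford) : cpi (repr x) = x.
Proof. exact: reprK. Qed.

Lemma cpi_surj (x : clifford) : exists t, x = cpi t.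
Proof. by exists (repr x); rewrite cpiK. Qed.

Lemma ceq_repr t : ceq (repr (cpi t)) t.
Proof. by apply/cpiP; rewrite cpiK. Qed.

Let cadd (x y : clifford) : clifford := cpi (CAdd (repr x) (repr y)).
Let cmul (x y : clifford) : clifford := cpi (CMul (repr x) (repr y)).
Let cscale (a : K) (x : clifford) : clifford := cpi (CMul (CCst a) (repr x)).

Let caddE s t : cadd (cpi s) (cpi t) = cpi (CAdd s t).
Proof. by apply/cpiP/ceq_add; apply: ceq_repr. Qed.

Let cmulE s t : cmul (cpi s) (cpi t) = cpi (CMul s t).
Proof. by apply/cpiP/ceq_mul; apply: ceq_repr. Qed.

Let cscaleE a t : cscale a (cpi t) = cpi (CMul (CCst a) t).
Proof. by apply/cpiP/ceq_mul; [apply: ceq_refl | apply: ceq_repr]. Qed.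

Let caddA : associative cadd.
Proof.
move=> x y z; have [[[s ->] [t ->]] [u ->]] := (cpi_surj x, cpi_surj y, cpi_surj z).
by rewrite !caddE; apply/cpiP/ceq_addA.
Qed.

Let caddC : commutative cadd.
Proof.
move=> x y; have [[s ->] [t ->]] := (cpi_surj x, cpi_surj y).
by rewrite !caddE; apply/cpiP/ceq_addC.
Qed.

Let cadd0 : left_id (cpi (CCst 0)) cadd.
Proof.
by move=> x; have [s ->] := cpi_surj x; rewrite caddE; apply/cpiP/ceq_add0.
Qed.

Let caddN : left_inverse (cpi (CCst 0)) (cscale (-1)) cadd.
Proof.
move=> x; have [s ->] := cpi_surj x; rewrite cscaleE caddE.
transitivity (cpi (CMul (CAdd (CCst (-1)) (CCst 1)) s)).
  apply/cpiP; apply: ceq_sym; apply: ceq_trans (ceq_mulDl _ _ _) _.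
  by apply: ceq_add; [apply: ceq_refl | apply: ceq_mul1].
transitivity (cpi (CMul (CCst 0) s)); last exact/cpiP/ceq_mul0.
apply/cpiP/ceq_mul; last exact: ceq_refl.
by rewrite -(addNr 1); apply: ceq_sym; apply: ceq_cstD.
Qed.

Let cmulA : associative cmul.
Proof.
move=> x y z; have [[[s ->] [t ->]] [u ->]] := (cpi_surj x, cpi_surj y, cpi_surj z).
by rewrite !cmulE; apply/cpiP/ceq_mulA.
Qed.

Let cmul1 : left_id (cpi (CCst 1)) cmul.
Proof.
by move=> x; have [s ->] := cpi_surj x; rewrite cmulE; apply/cpiP/ceq_mul1.
Qed.

Let cmulr1 : right_id (cpi (CCst 1)) cmul.
Proof.
move=> x; have [s ->] := cpi_surj x; rewrite cmulE; apply/cpiP.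
by apply: ceq_trans (ceq_sym (ceq_cstC _ _)) (ceq_mul1 _).
Qed.

Let cmulDl : left_distributive cmul cadd.
Proof.
move=> x y z; have [[[s ->] [t ->]] [u ->]] := (cpi_surj x, cpi_surj y, cpi_surj z).
by rewrite !(cmulE, caddE); apply/cpiP/ceq_mulDl.
Qed.

Let cmulDr : right_distributive cmul cadd.
Proof.
move=> x y z; have [[[s ->] [t ->]] [u ->]] := (cpi_surj x, cpi_surj y, cpi_surj z).
by rewrite !(cmulE, caddE); apply/cpiP/ceq_mulDr.
Qed.

HB.instance Definition _ := GRing.isPzRing.Build clifford
  caddA caddC cadd0 caddN cmulA cmul1 cmulr1 cmulDl cmulDr.

Let clifford1_neq0 : (1 : clifford) != 0.
Proof.
have [N [f f_sqr]] := clifford_map_exists.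
apply/eqP => /cpiP/(ceval_ceq f_sqr) /=.
by rewrite scale0r scale1r => /eqP; rewrite oner_eq0.
Qed.

HB.instance Definition _ :=
  GRing.PzSemiRing_isNonZero.Build clifford clifford1_neq0.

Let cscaleA a b x : cscale a (cscale b x) = cscale (a * b) x.
Proof.
have [s ->] := cpi_surj x; rewrite !cscaleE; apply/cpiP.
apply: ceq_trans (ceq_mulA _ _ _) _.
by apply/ceq_mul/ceq_refl/ceq_sym/ceq_cstM.
Qed.

Let cscale1 : left_id 1 cscale.
Proof.
by move=> x; have [s ->] := cpi_surj x; rewrite cscaleE; apply/cpiP/ceq_mul1.
Qed.

Let cscaleDr : right_distributive cscale +%R.
Proof.
move=> a x y; have [[s ->] [t ->]] := (cpi_surj x, cpi_surj y).
rewrite [cpi s + cpi t]caddE !cscaleE [RHS]caddE.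
exact/cpiP/ceq_mulDr.
Qed.

Let cscaleDl x : {morph cscale^~ x : a b / a + b}.
Proof.
move=> a b; have [s ->] := cpi_surj x.
rewrite !cscaleE [RHS]caddE; apply/cpiP.
apply: ceq_trans (ceq_mulDl _ _ _).
by apply/ceq_mul/ceq_refl/ceq_cstD.
Qed.

HB.instance Definition _ := GRing.Zmodule_isLmodule.Build K clifford
  cscaleA cscale1 cscaleDr cscaleDl.

Let cscaleAl (a : K) (x y : clifford) : a *: (x * y) = (a *: x) * y.
Proof.
have [[s ->] [t ->]] := (cpi_surj x, cpi_surj y).
rewrite [cpi s * _]cmulE [LHS]cscaleE [a *: _]cscaleE [RHS]cmulE.
exact/cpiP/ceq_mulA.
Qed.

HB.instance Definition _ := GRing.Lmodule_isLalgebra.Build K clifford cscaleAl.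

Let cscaleAr (a : K) (x y : clifford) : a *: (x * y) = x * (a *: y).
Proof.
have [[s ->] [t ->]] := (cpi_surj x, cpi_surj y).
rewrite [cpi s * _]cmulE [LHS]cscaleE [a *: _]cscaleE [RHS]cmulE.
apply/cpiP.
apply: ceq_trans (ceq_mulA _ _ _) _.
apply: ceq_trans (ceq_sym (ceq_mulA _ _ _)).
by apply/ceq_mul/ceq_refl/ceq_cstC.
Qed.

HB.instance Definition _ := GRing.Lalgebra_isAlgebra.Build K clifford cscaleAr.

Lemma cpiD s t : cpi (CAdd s t) = cpi s + cpi t.
Proof. exact/esym/caddE. Qed.

Lemma cpiM s t : cpi (CMul s t) = cpi s * cpi t.
Proof. exact/esym/cmulE. Qed.

Lemma cpi_cst a : cpi (CCst a) = a%:A.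
Proof. by rewrite [RHS]cscaleE -[LHS]cmulr1 cmulE. Qed.

Definition cgen (v : V) : clifford := cpi (CGen v).

Let cgen_linear : linear cgen.
Proof.
move=> a v w; rewrite /cgen -mulr_algl -cpi_cst -cpiM -cpiD.
exact/cpiP/ceq_genP.
Qed.

HB.instance Definition _ := GRing.isLinear.Build K V clifford _ cgen cgen_linear.

Lemma cgen_sqr v : cgen v * cgen v = (B v v)%:A.
Proof. by rewrite -cpi_cst -cpiM; apply/cpiP/ceq_gen_sqr. Qed.

Lemma clifford_ind (P : clifford -> Prop) :
    (forall v, P (cgen v)) -> (forall a : K, P a%:A) ->
    (forall x y, P x -> P y -> P (x + y)) ->
    (forall x y, P x -> P y -> P (x * y)) ->
  forall x, P x.
Proof.
move=> Pgen Pcst Padd Pmul x; have [t ->] := cpi_surj x.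
elim: t => [v|a|s Ps t Pt|s Ps t Pt]; first exact: Pgen.
- by rewrite cpi_cst; apply: Pcst.
- by rewrite cpiD; apply: Padd.
- by rewrite cpiM; apply: Pmul.
Qed.

End CliffordTerms.

Section CliffordLift.
Variables (K : numFieldType) (V : vectType K) (B : {symmetric V}).
Variables (A : algType K) (f : {linear V -> A}).
Hypothesis f_sqr : forall v, f v * f v = (B v v)%:A.

Definition clift (x : clifford B) : A := ceval f (repr x).

Let cliftE t : clift (cpi B t) = ceval f t.
Proof. exact/(ceval_ceq f_sqr)/ceq_repr. Qed.

Lemma clift_cgen v : clift (cgen B v) = f v.
Proof. by rewrite cliftE. Qed.

Lemma cliftD : {morph clift : x y / x + y}.
Proof.
move=> x y; have [[s ->] [t ->]] := (cpi_surj x, cpi_surj y).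
by rewrite -cpiD !cliftE.
Qed.

Lemma cliftM : {morph clift : x y / x * y}.
Proof.
move=> x y; have [[s ->] [t ->]] := (cpi_surj x, cpi_surj y).
by rewrite -cpiM !cliftE.
Qed.

Lemma clift_alg a : clift a%:A = a%:A.
Proof. by rewrite -cpi_cst cliftE. Qed.

Fact clift_linear : linear clift.
Proof.
move=> a x y; rewrite cliftD; congr (_ + _).
by rewrite -[in LHS]mulr_algl cliftM clift_alg mulr_algl.
Qed.

Fact clift_monoid : monoid_morphism clift.
Proof.
by split; [rewrite -[in LHS](scale1r 1) clift_alg scale1r | apply: cliftM].
Qed.

Definition clifford_lift : {lrmorphism clifford B -> A} :=
  HB.pack_for {lrmorphism clifford B -> A} clift
    (GRing.isLinear.Build _ _ _ _ clift clift_linear)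
    (GRing.isMonoidMorphism.Build _ _ clift clift_monoid).

Lemma clifford_lift_cgen v : clifford_lift (cgen B v) = f v.
Proof. exact: clift_cgen. Qed.

Lemma clifford_lift_unique (g : {lrmorphism clifford B -> A}) :
  (forall v, g (cgen B v) = f v) -> g =1 clifford_lift.
Proof.
move=> gf; elim/clifford_ind => [v|a|x y IHx IHy|x y IHx IHy].
- by rewrite clifford_lift_cgen.
- by rewrite !linearZ !rmorph1.
- by rewrite !raddfD /= IHx IHy.
- by rewrite !rmorphM /= IHx IHy.
Qed.

End CliffordLift.

Arguments clifford_lift : simpl never.

Section CliffordInvolutions.
Variables (K : numFieldType) (V : vectType K) (B : {symmetric V}).

Fact calpha_sqr v : (-%R \o cgen B) v * (-%R \o cgen B) v = (B v v)%:A.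
Proof. by rewrite /= mulrNN cgen_sqr. Qed.

(* The grading automorphism; the even part of the Clifford algebra is its     *)
(* fixed subalgebra.                                                          *)
Definition calpha : {lrmorphism clifford B -> clifford B} :=
  clifford_lift calpha_sqr.

Lemma calpha_cgen v : calpha (cgen B v) = - cgen B v.
Proof. exact: (clifford_lift_cgen calpha_sqr). Qed.

(* The reversal, i.e. the anti-automorphism v1 * ... * vk |-> vk * ... * v1.  *)
Fixpoint crev_term (t : cterm V) : cterm V :=
  match t with
  | CGen v => CGen v
  | CCst a => CCst V a
  | CAdd s t => CAdd (crev_term s) (crev_term t)
  | CMul s t => CMul (crev_term t) (crev_term s)
  end.

Let crev_term_ceq s t : ceq B s t -> ceq B (crev_term s) (crev_term t).
Proof.
elim=> /=.
- by move=> x; apply: ceq_refl.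
- by move=> x y _; apply: ceq_sym.
- by move=> x y z _ xy _; apply: ceq_trans.
- by move=> x x' y y' _ xx' _; apply: ceq_add.
- by move=> x x' y y' _ xx' _ yy'; apply: ceq_mul.
- by move=> x y z; apply: ceq_addA.
- by move=> x y; apply: ceq_addC.
- by move=> x; apply: ceq_add0.
- by move=> x y z; apply/ceq_sym/ceq_mulA.
- by move=> x y z; apply: ceq_mulDr.
- by move=> x y z; apply: ceq_mulDl.
- by move=> x; apply: ceq_trans (ceq_sym (ceq_cstC _ _ _)) (ceq_mul0 _ _).
- by move=> x; apply: ceq_trans (ceq_sym (ceq_cstC _ _ _)) (ceq_mul1 _ _).
- by move=> a x; apply/ceq_sym/ceq_cstC.
- by move=> a b; apply: ceq_cstD.
- by move=> a b; rewrite mulrC; apply: ceq_cstM.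
- move=> a v w; apply: ceq_trans (ceq_genP _ _ _ _) _.
  by apply: ceq_add (ceq_refl _ _); apply: ceq_cstC.
- by move=> v; apply: ceq_gen_sqr.
Qed.

Definition crev (x : clifford B) : clifford B := cpi B (crev_term (repr x)).

Let crevE t : crev (cpi B t) = cpi B (crev_term t).
Proof. by apply/cpiP/crev_term_ceq/ceq_repr. Qed.

Lemma crev_cgen v : crev (cgen B v) = cgen B v.
Proof. by rewrite crevE. Qed.

Lemma crev_alg a : crev a%:A = a%:A.
Proof. by rewrite -cpi_cst crevE. Qed.

Lemma crevD : {morph crev : x y / x + y}.
Proof.
move=> x y; have [[s ->] [t ->]] := (cpi_surj x, cpi_surj y).
by rewrite -cpiD !crevE -cpiD.
Qed.

Lemma crevM x y : crev (x * y) = crev y * crev x.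
Proof.
have [[s ->] [t ->]] := (cpi_surj x, cpi_surj y).
by rewrite -cpiM !crevE -cpiM.
Qed.

Lemma crev1 : crev 1 = 1.
Proof. by rewrite -(scale1r 1) crev_alg. Qed.

Lemma crevK : involutive crev.
Proof.
elim/clifford_ind => [v|a|x y IHx IHy|x y IHx IHy].
- by rewrite !crev_cgen.
- by rewrite !crev_alg.
- by rewrite !crevD IHx IHy.
- by rewrite !crevM IHx IHy.
Qed.

Lemma crev_alpha x : crev (calpha x) = calpha (crev x).
Proof.
have crevN v : crev (- cgen B v) = - cgen B v.
  by rewrite -linearN crev_cgen.
elim/clifford_ind: x => [v|a|x y IHx IHy|x y IHx IHy].
- by rewrite crev_cgen calpha_cgen crevN.
- by rewrite crev_alg !linearZ !rmorph1 crev_alg.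
- by rewrite crevD !raddfD /= crevD IHx IHy.
- by rewrite crevM !rmorphM /= crevM IHx IHy.
Qed.

End CliffordInvolutions.

(* Spin(V) is the group of even x with x V x^-1 = V and spinor norm           *)
(* x * crev x = 1, so that x^-1 = crev x.  In particular it is mu_2 = {1, -1} *)
(* when dim V = 1.                                                            *)
Section SpinGroup.
Local Open Scope classical_set_scope.
Variables (K : numFieldType) (V : vectType K) (B : {symmetric V}).

Definition is_spin (x : clifford B) : Prop :=
  [/\ calpha B x = x,
      x * crev x = 1 /\ crev x * x = 1 &
      [set x * y * crev x | y in range (cgen B)] = range (cgen B)].

Record spin : Type := Spin {
  spin_val :> clifford B;
  spin_valP : `[< is_spin spin_val >]
}.

HB.instance Definition _ := [isSub for spin_val].
HB.instance Definition _ := [Choice of spin by <:].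

Lemma is_spin1 : is_spin 1.
Proof.
split; first exact: rmorph1.
- by rewrite crev1 mulr1.
- rewrite crev1; under eq_imagel do rewrite mul1r mulr1.
  exact: image_id.
Qed.

Lemma is_spinM x y : is_spin x -> is_spin y -> is_spin (x * y).
Proof.
move=> [ax [x1 x2] xV] [ay [y1 y2] yV]; split.
- by rewrite -[in RHS]ax -[in RHS]ay; apply: rmorphM.
- rewrite crevM; split.
    by rewrite mulrA -[x * y * _]mulrA y1 mulr1.
  by rewrite mulrA -[crev y * _ * _]mulrA x2 mulr1.
- rewrite -[RHS]xV -[in RHS]yV [RHS]image_comp; apply: eq_imagel => z _ /=.
  by rewrite crevM !mulrA.
Qed.

Lemma is_spinV x : is_spin x -> is_spin (crev x).
Proof.
move=> [ax [x1 x2] xV]; rewrite /is_spin crevK; split=> //.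
- by rewrite -crev_alpha ax.
- rewrite -{1}xV [LHS]image_comp; apply: eq_image_id => z _ /=.
  by rewrite !mulrA x2 mul1r -mulrA x2 mulr1.
Qed.

Let mkspin x (sx : is_spin x) : spin := Spin (introT (asboolP _) sx).
Let spin_isP (x : spin) : is_spin x.
Proof. exact: (elimT (asboolP _) (spin_valP x)). Qed.

Definition spin_one : spin := mkspin is_spin1.
Definition spin_mul (x y : spin) : spin :=
  mkspin (is_spinM (spin_isP x) (spin_isP y)).
Definition spin_inv (x : spin) : spin := mkspin (is_spinV (spin_isP x)).

Let spin_mulA : associative spin_mul.
Proof. by move=> x y z; apply: val_inj; apply: mulrA. Qed.
Let spin_mul1 : left_id spin_one spin_mul.
Proof. by move=> x; apply: val_inj; apply: mul1r. Qed.
Let spin_mulr1 : right_id spin_one spin_mul.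
Proof. by move=> x; apply: val_inj; apply: mulr1. Qed.
Let spin_mulV : left_inverse spin_one spin_inv spin_mul.
Proof. by move=> x; apply: val_inj; case: (spin_isP x) => _ []. Qed.
Let spin_mulrV : right_inverse spin_one spin_inv spin_mul.
Proof. by move=> x; apply: val_inj; case: (spin_isP x) => _ []. Qed.

HB.instance Definition _ := isGroup.Build spin
  spin_mulA spin_mul1 spin_mulr1 spin_mulV spin_mulrV.

Lemma spin_valM (x y : spin) : spin_val (x * y)%g = spin_val x * spin_val y.
Proof. by []. Qed.

End SpinGroup.

Section SpinMap.
Local Open Scope classical_set_scope.
Variables (K : numFieldType) (V V' : vectType K).
Variables (B : {symmetric V}) (B' : {symmetric V'}) (f : {linear V -> V'}).
Hypothesis f_iso : forall u v, B' (f u) (f v) = B u v.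
Hypothesis f_surj : forall w, exists v, f v = w.

Fact cmap_sqr v : (cgen B' \o f) v * (cgen B' \o f) v = (B v v)%:A.
Proof. by rewrite /= cgen_sqr f_iso. Qed.

Definition cmap : {lrmorphism clifford B -> clifford B'} :=
  clifford_lift cmap_sqr.

Lemma cmap_cgen v : cmap (cgen B v) = cgen B' (f v).
Proof. exact: (clifford_lift_cgen cmap_sqr). Qed.

Lemma cmapD : {morph cmap : x y / x + y}.
Proof. exact: raddfD. Qed.

Lemma cmapM : {morph cmap : x y / x * y}.
Proof. exact: rmorphM. Qed.

Lemma cmap_alg a : cmap a%:A = a%:A.
Proof. by rewrite linearZ rmorph1. Qed.

Lemma cmap_alpha x : cmap (calpha B x) = calpha B' (cmap x).
Proof.
elim/clifford_ind: x => [v|a|x y IHx IHy|x y IHx IHy].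
- by rewrite calpha_cgen cmap_cgen calpha_cgen -cmap_cgen; apply: raddfN.
- by rewrite !linearZ !rmorph1.
- by rewrite !raddfD; congr (_ + _).
- by rewrite !rmorphM; congr (_ * _).
Qed.

Lemma cmap_rev x : cmap (crev x) = crev (cmap x).
Proof.
elim/clifford_ind: x => [v|a|x y IHx IHy|x y IHx IHy].
- by rewrite crev_cgen cmap_cgen crev_cgen.
- by rewrite crev_alg !linearZ !rmorph1 crev_alg.
- by rewrite crevD !cmapD crevD IHx IHy.
- by rewrite crevM !cmapM crevM IHx IHy.
Qed.

Lemma cmap_range : cmap @` range (cgen B) = range (cgen B').
Proof.
rewrite image_comp; apply/seteqP; split=> _ [v _ <-].
  by exists (f v) => //; apply/esym/cmap_cgen.
by have [w <-] := f_surj v; exists w => //; apply: cmap_cgen.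
Qed.

Lemma cmap_spin x : is_spin x -> is_spin (cmap x).
Proof.
move=> [ax [x1 x2] xV]; split.
- by rewrite -cmap_alpha ax.
- by rewrite -cmap_rev -!cmapM x1 x2 rmorph1.
- rewrite -cmap_range -[in RHS]xV [LHS]image_comp [RHS]image_comp.
  apply: eq_imagel => v _ /=; rewrite -cmap_rev -[RHS]/(cmap (x * v * crev x)).
  by rewrite [RHS]cmapM [in RHS]cmapM.
Qed.

Definition spin_map (x : spin B) : spin B' :=
  Spin (introT (asboolP _) (cmap_spin (elimT (asboolP _) (spin_valP x)))).

Lemma spin_map_val x : spin_val (spin_map x) = cmap (spin_val x).
Proof. by []. Qed.

Lemma spin_mapM : {morph spin_map : x y / (x * y)%g}.
Proof. by move=> x y; apply: val_inj; apply: rmorphM. Qed.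

End SpinMap.

Section SpinBlock.
Variables (K : numFieldType) (U W : vectType K).
Variables (BU : {symmetric U}) (BW : {symmetric W}).

Definition orthosum (x y : U * W) : K := BU x.1 y.1 + BW x.2 y.2.

Let orthosum_bilinear : bilinear_for
  (GRing.Scale.Law.clone _ _ *%R _) (GRing.Scale.Law.clone _ _ (idfun \; *%R) _)
  orthosum.
Proof.
split=> [y|x] a u v; rewrite /orthosum /=.
- by rewrite !linearPl /= mulrDr addrACA.
- by rewrite !linearP /= mulrDr addrACA.
Qed.

HB.instance Definition _ := bilinear_isBilinear.Build K
  (U * W)%type (U * W)%type K _ _ orthosum orthosum_bilinear.

Let orthosum_sym x y : orthosum x y = (-1) ^+ false * idfun (orthosum y x).
Proof.
rewrite expr0 mul1r /orthosum; congr (_ + _).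
- by rewrite [LHS](@hermitian_subproof _ _ _ _ BU) expr0 mul1r.
- by rewrite [LHS](@hermitian_subproof _ _ _ _ BW) expr0 mul1r.
Qed.

HB.instance Definition _ :=
  isHermitianSesquilinear.Build K (U * W)%type false idfun orthosum orthosum_sym.

Definition block_refl (x : U * W) : U * W := (x.1, - x.2).

Let block_refl_linear : linear block_refl.
Proof.
by move=> a [u w] [u' w']; congr (_, _); rewrite /= opprD scalerN.
Qed.

HB.instance Definition _ :=
  GRing.isLinear.Build K (U * W)%type (U * W)%type _ block_refl
    block_refl_linear.

Lemma block_refl_isometry x y :
  orthosum (block_refl x) (block_refl y) = orthosum x y.
Proof. by rewrite /orthosum /= linearNl linearN /= opprK. Qed.

Lemma block_refl_surj x : exists y, block_refl y = x.
Proof.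
by exists (block_refl x); case: x => u w; rewrite /block_refl /= opprK.
Qed.

Definition spin_theta : spin orthosum -> spin orthosum :=
  spin_map block_refl_isometry block_refl_surj.

Lemma spin_thetaM : {morph spin_theta : x y / (x * y)%g}.
Proof. exact: spin_mapM. Qed.

Lemma spin_thetaK : involutive spin_theta.
Proof.
move=> x; apply: val_inj.
change (cmap block_refl_isometry (cmap block_refl_isometry (spin_val x)) =
        spin_val x).
elim/clifford_ind: (spin_val x) => [v|a|y z IHy IHz|y z IHy IHz].
- rewrite !cmap_cgen; congr (cgen _ _).
  by case: v => u w; rewrite /= /block_refl /= opprK.
- by rewrite !linearZ !rmorph1.
- by rewrite !cmapD IHy IHz.
- by rewrite !cmapM IHy IHz.
Qed.

End SpinBlock.

Arguments spin_theta {K U W} BU BW x.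

(* Main.v *)
From HB Require Import structures.
Require Import Defs.
From mathcomp Require Import all_boot all_algebra sesquilinear.
From mathcomp Require Import boolp classical_sets reals complex.

(** The involution theta of Spin(E) comes from the reflection tau = (1, -1) of
    E = U (+) W.  Let theta(g) = g z with z central in Spin(E), and r + s > 2.

    A central element acts on E by a scalar c = 1 or -1: it commutes with the
    spin elements e f, for e, f in an orthonormal basis of E, and as soon as
    dim E > 2 these separate the basis lines ([center_vectors]).

    If c = -1, the isometry A of E induced by g satisfies tau A = - A tau, so A
    exchanges the eigenspaces U and W of tau and r = s, which is excluded
    ([anticommuting_twist_swaps], [block_swap_dim]).

    If c = 1, then z is an even central element of the Clifford algebra, so it
    is a scalar ([even_center_scalar]), hence z = 1 or z = -1 by the spinor norm
    condition.  When z = 1, g lies in H.  When z = -1, let w be the product of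
    the vectors of an orthonormal basis adapted to U (+) W.  As r + s is even,
    w is in Spin(E) and anticommutes with every vector, so it is central in
    Spin(E); since s is odd, theta(w) = - w ([theta_block_cprod]).  Then g w^-1
    is fixed by theta and g = (g w^-1) w. *)

Set Implicit Arguments.
Unset Strict Implicit.
Unset Printing Implicit Defensive.

Import GRing.Theory Num.Theory.
Local Open Scope ring_scope.

(** * Linear algebra *)

Lemma eq_opp_eq0 (K : numFieldType) (V : lmodType K) (v : V) : v = - v -> v = 0.
Proof.
move=> /eqP; rewrite -subr_eq0 opprK -mulr2n -scaler_nat scaler_eq0.
by rewrite pnatr_eq0 => /eqP.
Qed.

Lemma leq_dim_injective (K : fieldType) (U V : vectType K)
    (f : {linear U -> V}) :
  (forall u, f u = 0 -> u = 0) -> (\dim {:U} <= \dim {:V})%N.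
Proof.
move=> f_inj; rewrite -(@limg_dim_eq _ _ _ (linfun f) fullv).
  exact/dimvS/subvf.
apply/eqP; rewrite -subv0; apply/subvP => u; rewrite memv_cap memv_ker lfunE /=.
by rewrite memv0 => /andP[_ /eqP/f_inj ->].
Qed.

(** [block_refl] is the identity on U and minus the identity on W, so an
    injective map that anticommutes with it embeds each of U and W into the
    other. *)
Lemma block_swap_dim (K : numFieldType) (U W : vectType K)
    (f : {linear (U * W)%type -> (U * W)%type}) :
    (forall x, f x = 0 -> x = 0) ->
    (forall x, block_refl (f x) = - f (block_refl x)) ->
  \dim {:U} = \dim {:W}.
Proof.
move=> f_inj f_swap.
pose fU u := (f (u, 0)).2; pose fW w := (f (0, w)).1.
have fU_lin : linear fU.
  move=> a u v; rewrite /fU.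
  have -> : (a *: u + v, 0) = a *: (u, 0) + (v, 0) :> U * W.
    by congr (_, _); rewrite /= scaler0 addr0.
  by rewrite linearP.
have fW_lin : linear fW.
  move=> a u v; rewrite /fW.
  have -> : (0, a *: u + v) = a *: (0, u) + (0, v) :> U * W.
    by congr (_, _); rewrite /= scaler0 addr0.
  by rewrite linearP.
apply/eqP; rewrite eqn_leq; apply/andP; split.
  apply: (leq_dim_injective (f := HB.pack_for {linear U -> W} fU
           (GRing.isLinear.Build _ _ _ _ fU fU_lin))) => u /= fu0.
  have f1 : (f (u, 0)).1 = 0.
    have := congr1 fst (f_swap (u, 0)).
    by rewrite /block_refl /= oppr0 => /eq_opp_eq0.
  by have /f_inj[] : f (u, 0) = 0
    by rewrite [LHS]surjective_pairing f1 -/(fU u) fu0.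
apply: (leq_dim_injective (f := HB.pack_for {linear W -> U} fW
         (GRing.isLinear.Build _ _ _ _ fW fW_lin))) => w /= fw0.
have f2 : (f (0, w)).2 = 0.
  have := congr1 snd (f_swap (0, w)).
  have -> : block_refl (0, w) = - (0, w) :> U * W.
    by congr (_, _); rewrite /= ?oppr0.
  by rewrite (raddfN f) opprK => /= /esym/eq_opp_eq0.
by have /f_inj[] : f (0, w) = 0
  by rewrite [LHS]surjective_pairing f2 -/(fW w) fw0.
Qed.

(** * Orthonormal bases of quadratic spaces *)

Section OrthonormalSequences.
Variables (K : fieldType) (V : vectType K) (B : {symmetric V}).

Lemma symformC u v : B u v = B v u.
Proof. by rewrite [LHS](@hermitian_subproof _ _ _ _ B) expr0 mul1r. Qed.

Lemma nondegenerate_eq0 : nondegenerate B ->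
  forall v, (forall w, B v w = 0) -> v = 0.
Proof.
move=> /eqP rad0 v v0; apply/eqP; rewrite -memv0 -rad0.
by apply/mem_orthovP => w _; apply: v0.
Qed.

Fixpoint orthonormal_seq (s : seq V) : bool :=
  if s is e :: s' then
    [&& B e e == 1, all (fun f => B e f == 0) s' & orthonormal_seq s']
  else true.

(** Spanning is expressed by the expansion formula, the form used below. *)
Definition orthonormal_basis (s : seq V) : Prop :=
  orthonormal_seq s /\ forall v, v = \sum_(e <- s) B e v *: e.

Lemma orthonormal_seq_unit s e : orthonormal_seq s -> e \in s -> B e e = 1.
Proof.
elim: s => //= f s IHs /and3P[/eqP ff _ /IHs es].
by rewrite inE => /predU1P[->|].
Qed.

Lemma orthonormal_seq_orth s e f :
  orthonormal_seq s -> e \in s -> f \in s -> e != f -> B e f = 0.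
Proof.
elim: s => //= g s IHs /and3P[_ /allP gs /IHs{}IHs].
rewrite !inE => /predU1P[->|es] /predU1P[->|fs].
- by rewrite eqxx.
- by move=> _; apply/eqP/gs.
- by move=> _; rewrite symformC; apply/eqP/gs.
- exact: IHs.
Qed.

Lemma orthonormal_seq_sum s e (c : V -> K) : orthonormal_seq s -> e \in s ->
  B e (\sum_(f <- s) c f *: f) = c e.
Proof.
elim: s => //= g s IHs /and3P[/eqP gg /allP gs os].
rewrite inE big_cons linearDr linearZr_LR /= => /predU1P[->|es].
  rewrite gg mulr1 linear_sumr big_seq big1 ?addr0 // => f fs.
  by rewrite linearZr_LR /= (eqP (gs f fs)) mulr0.
by rewrite symformC (eqP (gs e es)) mulr0 add0r IHs.
Qed.

Lemma orthonormal_seq_free s : orthonormal_seq s -> free s.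
Proof.
elim: s => [|e s IHs] /=; first by rewrite nil_free.
case/and3P => /eqP ee /allP es os; rewrite free_cons IHs // andbT.
apply: contra_eqN ee => espan.
have /subvP/(_ e espan) : (<<s>> <= orthov B <[e]>)%VS.
  by apply/span_subvP => f fs; rewrite mem_orthov1 symformC; apply: es.
by rewrite mem_orthov1 => /eqP->; rewrite eq_sym oner_eq0.
Qed.

Lemma orthonormal_basis_size s : orthonormal_basis s -> size s = \dim {:V}.
Proof.
move=> [os sV]; have /eqP <- := orthonormal_seq_free os.
congr (\dim _); apply/eqP; rewrite eqEsubv subvf; apply/subvP => v _.
rewrite (sV v) big_seq rpred_sum // => e es.
by apply: rpredZ; apply: memv_span.
Qed.

Lemma orthonormal_basis_nondegenerate s :
  orthonormal_basis s -> nondegenerate B.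
Proof.
move=> [_ sV]; rewrite /nondegenerate -subv0; apply/subvP => v /mem_orthovP v0.
rewrite (sV v) big1 ?mem0v // => e _.
by rewrite symformC v0 ?memvf // scale0r.
Qed.

End OrthonormalSequences.

Section OrthonormalBases.
Variables (K : numClosedFieldType) (V : vectType K) (B : {symmetric V}).
Hypothesis B_nondeg : nondegenerate B.

(** If every vector orthogonal to [s] were isotropic, the form would vanish on
    the orthogonal complement of [s] by polarization; the component of [x]
    orthogonal to [s] would then lie in the radical.  So the complement contains
    an anisotropic vector, which can be normalized over a closed field. *)
Lemma orthonormal_seq_extend s x : orthonormal_seq B s ->
  x != \sum_(e <- s) B e x *: e -> exists e, orthonormal_seq B (e :: s).
Proof.
move=> os xNs; pose p y := y - \sum_(e <- s) B e y *: e.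
have p_orth y e : e \in s -> B e (p y) = 0.
  by move=> es; rewrite linearBr /= orthonormal_seq_sum // subrr.
have [[e [es ee0]]|isotropic] :=
    pselect (exists e, (forall f, f \in s -> B f e = 0) /\ B e e != 0).
  exists ((sqrtC (B e e))^-1 *: e) => /=; rewrite os andbT; apply/andP; split.
    rewrite linearZr_LR.
    rewrite linearZl_LR /=.
    rewrite mulrA -invfM -expr2 sqrtCK.
    by rewrite mulVf.
  apply/allP => f fs.
  by rewrite linearZl_LR /= (symformC B e f) (es f fs) mulr0 eqxx.
have orth_isotropic e : (forall f, f \in s -> B f e = 0) -> B e e = 0.
  by move=> es; apply/eqP/negPn/negP => ee; apply: isotropic; exists e.
(* Otherwise the component [p x] orthogonal to [s] is in the radical. *)
case/negP: xNs; rewrite -subr_eq0; apply/eqP.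
apply: (nondegenerate_eq0 B_nondeg) => y.
rewrite -[y](subrK (\sum_(e <- s) B e y *: e)) -/(p x) -/(p y) linearDr /=.
rewrite [X in _ + X]linear_sumr big_seq big1 => [|e es]; last first.
  by rewrite linearZr_LR /= (symformC B (p x) e) (p_orth x e es) mulr0.
rewrite addr0.
suff: B (p x) (p y) *+ 2 = 0 by move=> /eqP; rewrite mulrn_eq0 => /eqP.
have : B (p x + p y) (p x + p y) = 0.
  by apply: orth_isotropic => f fs; rewrite linearDr /= !p_orth ?addr0.
have pp z : B (p z) (p z) = 0 by apply: orth_isotropic => f; apply: p_orth.
rewrite linearDr !(linearDl _ _ (p x) (p y)) /= !pp add0r addr0.
by rewrite (symformC B (p y)) -mulr2n.
Qed.

Lemma orthonormal_basis_exists : exists s, orthonormal_basis B s.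
Proof.
have [n] := ubnP (\dim {:V}); rewrite -[\dim _]subn0 -[0%N]/(size (@nil V)).
have : orthonormal_seq B [::] by [].
elim: n [::] => [//|n IHn] s os; rewrite ltnS => sn.
have [sV|/existsNP[x /eqP xNs]] :=
  pselect (forall v, v = \sum_(e <- s) B e v *: e); first by exists s.
have [e oes] := orthonormal_seq_extend os xNs.
apply: (IHn _ oes); apply: leq_trans sn; rewrite ltn_sub2l //=.
by have /eqP/= <- := orthonormal_seq_free oes; apply/dimvS/subvf.
Qed.

End OrthonormalBases.

(** * Vectors in the Clifford algebra *)

Section CliffordRelations.
Variables (K : numFieldType) (V : vectType K) (B : {symmetric V}).
Implicit Types (x y : clifford B) (u v e : V) (s : seq V).
Local Notation gen := (cgen B).

Lemma clifford_alg_eq0 (a : K) : (a%:A == 0 :> clifford B) = (a == 0).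
Proof. by rewrite scaler_eq0 oner_eq0 orbF. Qed.

Lemma cgen_polar u v : gen u * gen v + gen v * gen u = (B u v *+ 2)%:A.
Proof.
have := cgen_sqr B (u + v).
rewrite linearD mulrDl !mulrDr !cgen_sqr linearDr !linearDl /=.
rewrite (symformC B v u) !scalerDl => /eqP.
by rewrite -!addrA (inj_eq (addrI _)) !addrA (inj_eq (addIr _)) => /eqP->.
Qed.

Lemma cgen_orth u v : B u v = 0 -> gen u * gen v = - (gen v * gen u).
Proof.
move=> uv; apply/eqP; rewrite -addr_eq0 cgen_polar uv.
by rewrite mul0rn scale0r.
Qed.

Lemma cgen_unit e : B e e = 1 -> gen e * gen e = 1.
Proof. by move=> ee; rewrite cgen_sqr ee scale1r. Qed.

Lemma cgen_inj : nondegenerate B -> injective gen.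
Proof.
move=> ndB u v /eqP; rewrite -subr_eq0 -linearB => /eqP uv0.
apply/eqP; rewrite -subr_eq0; apply/eqP/(nondegenerate_eq0 ndB) => w.
have /eqP := cgen_polar (u - v) w.
rewrite uv0 mul0r mulr0 addr0 eq_sym clifford_alg_eq0 mulrn_eq0 /=.
by move/eqP.
Qed.

Lemma calphaM x y : calpha B (x * y) = calpha B x * calpha B y.
Proof. exact: rmorphM. Qed.

Lemma calphaD x y : calpha B (x + y) = calpha B x + calpha B y.
Proof. exact: raddfD. Qed.

Lemma calpha_alg (c : K) : calpha B c%:A = c%:A.
Proof. by rewrite linearZ rmorph1. Qed.

Lemma calphaN x : calpha B (- x) = - calpha B x.
Proof. exact: raddfN. Qed.

Lemma calphaK : involutive (calpha B).
Proof.
elim/clifford_ind => [v|a|x y IHx IHy|x y IHx IHy].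
- by rewrite calpha_cgen calphaN calpha_cgen opprK.
- by rewrite !calpha_alg.
- by rewrite !calphaD IHx IHy.
- by rewrite !calphaM IHx IHy.
Qed.

(** In particular such an [x] commutes with all even elements. *)
Lemma anticommute_with_vectors x :
  (forall v, x * gen v = - (gen v * x)) -> forall y, x * y = calpha B y * x.
Proof.
move=> xv; elim/clifford_ind => [v|a|y z IHy IHz|y z IHy IHz].
- by rewrite xv calpha_cgen mulNr.
- by rewrite calpha_alg mulr_algl mulr_algr.
- by rewrite calphaD mulrDl mulrDr IHy IHz.
- by rewrite calphaM mulrA IHy -(mulrA _ x z) IHz mulrA.
Qed.

End CliffordRelations.

(** * Products of unit vectors *)

Section UnitProducts.
Local Open Scope classical_set_scope.
Variables (K : numFieldType) (V : vectType K) (B : {symmetric V}).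
Implicit Types (x y : clifford B) (u v e : V) (s : seq V).
Local Notation gen := (cgen B).

Definition cprod (s : seq V) : clifford B := \prod_(e <- s) gen e.

Lemma cprod_cons e s : cprod (e :: s) = gen e * cprod s.
Proof. by rewrite /cprod big_cons. Qed.

Lemma calpha_cprod s : calpha B (cprod s) = (-1) ^+ size s *: cprod s.
Proof.
elim: s => [|e s IHs]; first by rewrite /cprod big_nil rmorph1 scale1r.
rewrite cprod_cons calphaM calpha_cgen IHs exprS mulN1r scaleNr.
by rewrite mulNr -scalerAr.
Qed.

Lemma cprod_crev s : {in s, forall e, B e e = 1} ->
  cprod s * crev (cprod s) = 1 /\ crev (cprod s) * cprod s = 1.
Proof.
elim: s => [|e s IHs] s1; first by rewrite /cprod big_nil crev1 mulr1.
have [|sl sr] := IHs; first by move=> f fs; apply: s1; rewrite inE fs orbT.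
have ee : gen e * gen e = 1 by apply/cgen_unit/s1/mem_head.
rewrite cprod_cons crevM crev_cgen; split.
  by rewrite mulrA -[gen e * _ * _]mulrA sl mulr1.
by rewrite mulrA -[_ * gen e * gen e]mulrA ee mulr1.
Qed.

(** Up to sign, conjugation by a unit vector is the orthogonal reflection in it,
    so it preserves the space of vectors. *)
Lemma cgen_sandwich e v : B e e = 1 ->
  gen e * gen v * gen e = gen ((B e v *+ 2) *: e - v).
Proof.
move=> ee.
have -> : gen e * gen v = (B e v *+ 2)%:A - gen v * gen e.
  by rewrite -cgen_polar addrK.
by rewrite linearB linearZ /= mulrBl mulr_algl -mulrA cgen_unit ?mulr1.
Qed.

Lemma is_spin_cprod s : {in s, forall e, B e e = 1} -> ~~ odd (size s) ->
  is_spin (cprod s).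
Proof.
move=> s1 s_even; split; last 1 first.
- elim: s s1 {s_even} => [|e s IHs] s1.
    rewrite /cprod big_nil crev1; under eq_imagel do rewrite mul1r mulr1.
    exact: image_id.
  have ee : B e e = 1 by apply/s1/mem_head.
  rewrite -[RHS](_ : [set gen e * y * gen e | y in range gen] = range gen).
    rewrite -[in RHS]IHs => [|f fs]; last by apply: s1; rewrite inE fs orbT.
    rewrite [RHS]image_comp; apply: eq_imagel => y _ /=.
    by rewrite cprod_cons crevM crev_cgen !mulrA.
  apply/seteqP; split=> [_ [_ [v _ <-] <-]|_ [v _ <-]].
    by rewrite /= cgen_sandwich //; apply: imageT.
  exists (gen e * gen v * gen e).
    by rewrite cgen_sandwich //; apply: imageT.
  by rewrite !mulrA cgen_unit // mul1r -mulrA cgen_unit // mulr1.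
- by rewrite calpha_cprod -signr_odd (negPf s_even) scale1r.
- exact: cprod_crev.
Qed.

Lemma cprod_orth s v : {in s, forall e, B e v = 0} ->
  cprod s * gen v = (-1) ^+ size s *: (gen v * cprod s).
Proof.
elim: s => [|e s IHs] sv.
  by rewrite /cprod big_nil mul1r mulr1 scale1r.
have ev : B e v = 0 by apply/sv/mem_head.
rewrite cprod_cons -mulrA IHs => [|f fs]; last first.
  by apply: sv; rewrite inE fs orbT.
rewrite -scalerAr (mulrA (gen e)) (cgen_orth ev) /= exprS mulN1r scaleNr.
by rewrite mulNr scalerN mulrA.
Qed.

(** Moving [e] across the product changes the sign once for each factor other
    than [e] itself. *)
Lemma cprod_mem s e : orthonormal_seq B s -> e \in s ->
  cprod s * gen e = - ((-1) ^+ size s *: (gen e * cprod s)).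
Proof.
elim: s => //= f s IHs /and3P[/eqP ff /allP fs os]; rewrite exprS mulN1r.
rewrite scaleNr opprK cprod_cons inE => /predU1P[->|es].
  rewrite -mulrA cprod_orth -?scalerAr // => g /fs.
  by rewrite symformC => /eqP.
have fe : B f e = 0 by apply/eqP/fs.
rewrite -mulrA IHs // mulrN -scalerAr (mulrA (gen f)) (cgen_orth fe).
by rewrite mulNr scalerN opprK mulrA.
Qed.

Lemma cprod_basis_vector s v : orthonormal_basis B s -> ~~ odd (size s) ->
  cprod s * gen v = - (gen v * cprod s).
Proof.
move=> [os sV] s_even; rewrite (sV v) linear_sum mulr_sumr mulr_suml -sumrN.
rewrite big_seq [RHS]big_seq; apply: eq_bigr => e es.
rewrite linearZ /= -scalerAl -scalerAr -scalerN; congr (_ *: _).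
by rewrite cprod_mem // -signr_odd (negPf s_even) scale1r.
Qed.

End UnitProducts.

(** * The even centre of the Clifford algebra *)

Section EvenCentre.
Variables (K : numFieldType) (V : vectType K) (B : {symmetric V}).
Implicit Types (x y : clifford B) (u v e : V) (s : seq V).
Local Notation gen := (cgen B).

(** The subalgebra generated by an orthonormal sequence, presented through the
    splitting A (+) e A of the algebra generated by one further vector [e]. *)
Fixpoint cgenerated (s : seq V) (x : clifford B) : Prop :=
  if s is e :: s' then
    exists a b, [/\ cgenerated s' a, cgenerated s' b & x = a + gen e * b]
  else exists c : K, x = c%:A.

Lemma cgenerated_lincomb s (c : K) x y :
  cgenerated s x -> cgenerated s y -> cgenerated s (c *: x + y).
Proof.
elim: s x y => [|e s IHs] x y /=.
  by move=> [a ->] [b ->]; exists (c * a + b); rewrite scalerDl scalerA.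
move=> [a [b [sa sb ->]]] [a' [b' [sa' sb' ->]]].
exists (c *: a + a'), (c *: b + b'); split; do ?exact: IHs.
by rewrite scalerDr addrACA mulrDr scalerAr.
Qed.

Lemma cgenerated_cst s (c : K) : cgenerated s c%:A.
Proof.
elim: s c => [|e s IHs] c /=; first by exists c.
exists c%:A, 0; split=> //; last by rewrite mulr0 addr0.
by rewrite -(scale0r 1).
Qed.

Lemma cgeneratedZ s (c : K) x : cgenerated s x -> cgenerated s (c *: x).
Proof.
move=> sx; rewrite -[_ *: _]addr0 -(scale0r 1).
exact/cgenerated_lincomb/cgenerated_cst.
Qed.

Lemma cgenerated_mul_mem s e x : orthonormal_seq B s -> e \in s ->
  cgenerated s x -> cgenerated s (gen e * x).
Proof.
elim: s x => //= f s IHs x /and3P[/eqP ff /allP fs os].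
rewrite inE => /predU1P[->|es] [a [b [sa sb ->]]].
  by exists b, a; split=> //; rewrite mulrDr mulrA cgen_unit // mul1r addrC.
exists (gen e * a), ((-1) *: (gen e * b)); split.
- exact: IHs.
- exact/cgeneratedZ/IHs.
- rewrite mulrDr !mulrA (cgen_orth (u := e)) ?mulNr ?scaleN1r ?mulrN ?mulrA //.
  by rewrite symformC; apply/eqP/fs.
Qed.

(** The generated subspace contains 1 and is stable by left multiplication by
    vectors, hence by everything. *)
Lemma cgenerated_full s x : orthonormal_basis B s -> cgenerated s x.
Proof.
move=> [os sV]; rewrite -[x]mulr1.
have : cgenerated s 1 by rewrite -(scale1r 1); apply: cgenerated_cst.
elim/clifford_ind: x 1 => [v|a|x y IHx IHy|x y IHx IHy] z sz.
- rewrite (sV v) linear_sum mulr_suml big_seq.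
  elim/big_rec: _ => [|e y es sy].
    by rewrite -(scale0r 1); apply: cgenerated_cst.
  rewrite linearZ /= -scalerAl.
  exact/cgenerated_lincomb/sy/cgenerated_mul_mem.
- by rewrite mulr_algl; apply: cgeneratedZ.
- rewrite mulrDl -[x * z]scale1r.
  by apply: cgenerated_lincomb; [apply: IHx | apply: IHy].
- by rewrite -mulrA; apply/IHx/IHy.
Qed.

Lemma cgenerated_cross s e x : cgenerated s x -> {in s, forall f, B e f = 0} ->
  gen e * x = calpha B x * gen e.
Proof.
elim: s x => [x [c ->] _|f s IHs x [a [b [sa sb ->]]] es].
  by rewrite calpha_alg mulr_algl mulr_algr.
have es' : {in s, forall f, B e f = 0}.
  by move=> g gs; apply: es; rewrite inE gs orbT.
rewrite calphaD calphaM calpha_cgen mulrDr mulrDl IHs //; congr (_ + _).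
rewrite mulrA cgen_orth; last exact/es/mem_head.
by rewrite mulNr -(mulrA _ _ b) (IHs b) // mulrA !mulNr.
Qed.

(** Eliminate the basis vectors one at a time.  Write x = a + e b with a and b
    free of [e].  Conjugation by [e] sends x to calpha a + e (calpha b), while
    calpha x = calpha a - e (calpha b); both equal x, so b = 0. *)
Lemma even_center_scalar s x : orthonormal_basis B s -> calpha B x = x ->
  (forall v, x * gen v = gen v * x) -> exists c : K, x = c%:A.
Proof.
move=> sB x_even x_center; have := cgenerated_full x sB.
have [os _] := sB; elim: s os {sB} => //= e s IHs /and3P[/eqP ee /allP es os].
move=> [a [b [sa sb xE]]]; apply: IHs => //.
have es0 : {in s, forall f, B e f = 0} by move=> f /es/eqP.
suff b0 : b = 0 by rewrite xE b0 mulr0 addr0.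
have exe : gen e * x * gen e = x.
  by rewrite -x_center -mulrA cgen_unit // mulr1.
have eaa : gen e * a * gen e = calpha B a.
  by rewrite (cgenerated_cross sa) // -mulrA cgen_unit // mulr1.
have eb : gen e * calpha B b = b * gen e.
  have := cgenerated_cross sb es0.
  move/(congr1 (calpha B)); rewrite !calphaM calphaK calpha_cgen.
  by rewrite mulNr mulrN => /oppr_inj.
have be : b * gen e = - (b * gen e).
  have : calpha B x = gen e * x * gen e by rewrite exe.
  rewrite xE calphaD calphaM calpha_cgen mulrDr mulrDl eaa => /addrI.
  by rewrite mulNr eb mulrA cgen_unit // mul1r => ->.
by rewrite -[b]mulr1 -(cgen_unit ee) mulrA (eq_opp_eq0 be) mul0r.
Qed.

End EvenCentre.

(** * The centre of the spin group *)

Section SpinCentre.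
Variables (K : numFieldType) (V : vectType K) (B : {symmetric V}).
Implicit Types (u v e : V) (s : seq V).
Local Notation gen := (cgen B).

Lemma spinP (x : spin B) : is_spin (spin_val x).
Proof. exact: (elimT (asboolP _) (spin_valP x)). Qed.

Lemma spin_val_inj : injective (@spin_val _ _ B).
Proof. exact: val_inj. Qed.

Lemma group_center_commute (z : spin B) (x : clifford B) :
  group_center z -> is_spin x -> spin_val z * x = x * spin_val z.
Proof.
move=> zZ sx.
exact: (congr1 (@spin_val _ _ B) (zZ (Spin (introT (asboolP _) sx)))).
Qed.

Lemma spin_conj_vector (x : spin B) v :
  exists w, spin_val x * gen v * crev (spin_val x) = gen w.
Proof.
have [_ _ xV] := spinP x.
have : range gen (spin_val x * gen v * crev (spin_val x)).
  by rewrite -xV; exists (gen v) => //; apply: imageT.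
by case=> w _ <-; exists w.
Qed.

Lemma spin_conj_linear (x : spin B) : nondegenerate B ->
  exists f : {linear V -> V},
    forall v, spin_val x * gen v * crev (spin_val x) = gen (f v).
Proof.
move=> ndB; have [f fE] := choice (spin_conj_vector x).
have f_lin : linear f.
  move=> a u v; apply: (cgen_inj ndB); rewrite linearP /= -!fE linearP /=.
  by rewrite mulrDr mulrDl -scalerAr -scalerAl.
by exists (HB.pack_for {linear V -> V} f
             (GRing.isLinear.Build _ _ _ _ f f_lin)).
Qed.

Lemma is_spin_mul_units e f : B e e = 1 -> B f f = 1 -> is_spin (gen e * gen f).
Proof.
move=> ee ff.
have -> : gen e * gen f = cprod B [:: e; f].
  by rewrite !cprod_cons /cprod big_nil mulr1.
by apply: is_spin_cprod => // g; rewrite !inE => /orP[]/eqP->.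
Qed.

Lemma orthonormal_third s e g : orthonormal_seq B s -> (2 < size s)%N ->
  exists f, [/\ f \in s, f != e & f != g].
Proof.
move=> os s3; have /hasP[f fs] : has (predC (mem [:: e; g])) s.
  rewrite has_predC; apply: contraL s3 => /allP sub; rewrite -leqNgt.
  exact: uniq_leq_size (free_uniq (orthonormal_seq_free os)) sub.
by rewrite /= !inE negb_or => /andP[fe fg]; exists f.
Qed.

(** Conjugation by [z] sends [e] to a vector [e'] orthogonal to any other basis
    vector [g]: choose a third basis vector [f]; the spin element p = f e
    commutes with z and g and anticommutes with e, hence with [e'], so it
    anticommutes with the scalar g e' + e' g = 2 B(g, e'), which must vanish. *)
Lemma center_basis_vector s (z : spin B) e : orthonormal_basis B s ->
    (2 < size s)%N -> group_center z -> e \in s ->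
  exists c : K, spin_val z * gen e = c *: (gen e * spin_val z).
Proof.
move=> [os sV] s3 zZ es; have [e' e'E] := spin_conj_vector z e.
have [_ [zz' z'z] _] := spinP z.
have ze : spin_val z * gen e = gen e' * spin_val z.
  by rewrite -e'E -[RHS]mulrA z'z mulr1.
exists (B e e'); rewrite ze scalerAl -linearZ /=; congr (gen _ * _).
rewrite [LHS]sV (bigD1_seq e es (free_uniq (orthonormal_seq_free os))) /=.
rewrite big_seq_cond big1 ?addr0 // => g /andP[gs gNe].
suff -> : B g e' = 0 by rewrite scale0r.
have [f [fs fNe fNg]] := orthonormal_third e g os s3.
pose p := gen f * gen e.
have ff := orthonormal_seq_unit os fs; have ee := orthonormal_seq_unit os es.
have fe0 := orthonormal_seq_orth os fs es fNe.
have fg0 := orthonormal_seq_orth os fs gs fNg.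
have eg0 : B e g = 0 by rewrite symformC (orthonormal_seq_orth os gs es).
have pz : spin_val z * p = p * spin_val z.
  by apply: group_center_commute => //; apply: is_spin_mul_units.
have pe : p * gen e = - (gen e * p).
  by rewrite /p {1}(cgen_orth fe0) mulNr -!mulrA.
have pg : p * gen g = gen g * p.
  rewrite /p -mulrA (cgen_orth eg0) mulrN (mulrA (gen f)) (cgen_orth fg0).
  by rewrite mulNr opprK mulrA.
have p'p : crev p * p = 1 by have [_ []] := is_spin_mul_units ff ee.
(* [p] is made opaque so that reassociating products leaves it whole. *)
clearbody p.
have pz' : p * crev (spin_val z) = crev (spin_val z) * p.
  rewrite -[LHS]mul1r -z'z -mulrA (mulrA (spin_val z)) pz.
  by rewrite -(mulrA p) zz' mulr1.
have pe' : p * gen e' = - (gen e' * p).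
  rewrite -e'E !mulrA -pz -(mulrA _ p) pe mulrN mulNr -!mulrA -pz'.
  by rewrite !mulrA.
have pB : (B g e' *+ 2) *: p = 0.
  apply: eq_opp_eq0; rewrite -[in LHS]mulr_algr -[in RHS]mulr_algl.
  rewrite -(cgen_polar B) mulrDr mulrDl mulrA pg -mulrA pe' (mulrA p) pe'.
  by rewrite mulrN mulNr -opprD -[in LHS](mulrA _ p) pg !mulrA.
have : (B g e' *+ 2)%:A = 0 :> clifford B.
  by rewrite -p'p scalerAr pB mulr0.
by move/eqP; rewrite clifford_alg_eq0 mulrn_eq0 => /eqP.
Qed.

(** The eigenvalues a and b of [z] on two distinct basis vectors e and f satisfy
    a b = 1, because [z] commutes with e f.  Comparing with a third vector makes
    all the eigenvalues equal, and then their squares are 1. *)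
Lemma center_vectors s (z : spin B) : orthonormal_basis B s ->
    (2 < size s)%N -> group_center z ->
  exists c : K, (c = 1 \/ c = -1) /\
    forall v, spin_val z * gen v = c *: (gen v * spin_val z).
Proof.
move=> sB s3 zZ; have [os sV] := sB.
have zE := center_basis_vector sB s3 zZ.
have cc1 e f (a b : K) : e \in s -> f \in s -> e != f ->
    spin_val z * gen e = a *: (gen e * spin_val z) ->
    spin_val z * gen f = b *: (gen f * spin_val z) -> a * b = 1.
  move=> es fs eNf ze zf.
  have p_spin : is_spin (gen e * gen f).
    by apply: is_spin_mul_units; apply: orthonormal_seq_unit os _.
  have := group_center_commute zZ p_spin.
  rewrite mulrA ze -scalerAl -(mulrA _ _ (gen f)) zf -scalerAr scalerA mulrA.
  move/eqP; rewrite -[X in _ == X]scale1r -subr_eq0 -scalerBl scaler_eq0.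
  case/orP => [/eqP/subr0_eq //|/eqP pz0].
  have [_ [+ _] _] := is_spinM p_spin (spinP z).
  by rewrite pz0 mul0r => /esym/eqP; rewrite oner_eq0.
have [e es] : exists e, e \in s.
  by case: s s3 {sB os sV zE cc1} => // e s _; exists e; apply: mem_head.
have [c zec] := zE e es.
have [f [fs fNe _]] := orthonormal_third e e os s3.
have same g : g \in s -> spin_val z * gen g = c *: (gen g * spin_val z).
  move=> gs; have [d zgd] := zE g gs; rewrite zgd; congr (_ *: _).
  have [h [hs hNe hNg]] := orthonormal_third e g os s3.
  have [b zhb] := zE h hs.
  have bc := cc1 _ _ _ _ hs es hNe zhb zec.
  have bd := cc1 _ _ _ _ hs gs hNg zhb zgd.
  by rewrite -[d]mul1r -bc mulrAC bd mul1r.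
exists c; split.
  have /eqP := cc1 _ _ _ _ fs es fNe (same f fs) zec.
  by rewrite -expr2 sqrf_eq1 => /orP[]/eqP; [left | right].
move=> v; rewrite (sV v) linear_sum mulr_sumr mulr_suml scaler_sumr.
rewrite big_seq [RHS]big_seq; apply: eq_bigr => g gs.
rewrite linearZ /= -scalerAr same // -scalerAl !scalerA; congr (_ *: _).
exact: mulrC.
Qed.

End SpinCentre.

(** * The block involution *)

Section SpinBlockPair.
Variables (K : numFieldType) (U W : vectType K).
Variables (BU : {symmetric U}) (BW : {symmetric W}).
Local Notation E := (U * W)%type.
Local Notation B := (orthosum BU BW).
Local Notation gen := (cgen B).

Definition block_seq (sU : seq U) (sW : seq W) : seq E :=
  [seq (u, 0) | u <- sU] ++ [seq (0, w) | w <- sW].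

Lemma block_basis sU sW : orthonormal_basis BU sU -> orthonormal_basis BW sW ->
  orthonormal_basis B (block_seq sU sW).
Proof.
move=> [oU UV] [oW WV]; split.
  elim: sU oU {UV} => [_|u sU IHs /= /and3P[uu uo oU]].
    elim: sW oW {WV} => //= w sW IHs /and3P[ww wo oW].
    rewrite /orthosum /= linear0l add0r ww IHs // andbT.
    apply/allP => _ /mapP[w' w's ->] /=.
    by rewrite linear0l add0r (allP wo).
  rewrite IHs // andbT {1}/orthosum /= linear0l addr0 uu /=.
  apply/allP => x; rewrite mem_cat => /orP[] /mapP[v vs ->].
    by rewrite /orthosum /= linear0l addr0 (allP uo).
  by rewrite /orthosum /= linear0l linear0r addr0.
move=> [u w]; rewrite big_cat /= !big_map [LHS]surjective_pairing /=.
rewrite [X in _ = X + _](_ : _ = (u, 0)); last first.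
  rewrite [in RHS](UV u); elim/big_rec2: _ => // x y v _ ->.
  by rewrite /orthosum /= linear0l addr0; congr (_, _); rewrite /= scaler0 addr0.
rewrite [X in _ = _ + X](_ : _ = (0, w)).
  by congr (_, _); rewrite /= ?addr0 ?add0r.
rewrite [in RHS](WV w); elim/big_rec2: _ => // x y v _ ->.
by rewrite /orthosum /= linear0l add0r; congr (_, _); rewrite /= scaler0 addr0.
Qed.

Lemma spin_theta_val (x : spin B) :
  spin_val (spin_theta BU BW x) =
  cmap (@block_refl_isometry _ _ _ BU BW) (spin_val x).
Proof. by []. Qed.

Local Notation theta := (cmap (@block_refl_isometry _ _ _ BU BW)).

Lemma theta_block_cprod sU sW :
  theta (cprod B (block_seq sU sW)) =
  (-1) ^+ size sW *: cprod B (block_seq sU sW).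
Proof.
elim: sU => [|u sU IHs]; last first.
  rewrite -[block_seq _ _]/((u, 0) :: block_seq sU sW) cprod_cons.
  rewrite cmapM cmap_cgen IHs -scalerAr; congr (_ *: (gen _ * _)).
  by congr (_, _); rewrite /= oppr0.
elim: sW => [|w sW IHs]; first by rewrite /cprod big_nil rmorph1 scale1r.
have refl_w : gen (block_refl (0, w)) = - gen (0, w).
  rewrite -[RHS](raddfN gen) /=; congr (gen _).
  by congr (_, _); rewrite /= oppr0.
rewrite -[block_seq _ _]/((0, w) :: block_seq [::] sW) cprod_cons.
rewrite cmapM cmap_cgen IHs refl_w -scalerAr mulNr scalerN -scaleNr.
by rewrite -mulN1r -exprS.
Qed.

(** Apply theta to g v g^-1 = A v, where A is the isometry of E induced by [g]:
    the left-hand side becomes g z tau(v) z^-1 g^-1 = - A (tau v), and the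
    right-hand side tau (A v). *)
Lemma anticommuting_twist_swaps (g z : spin B) : nondegenerate B ->
    spin_theta BU BW g = (g * z)%g ->
    (forall v, spin_val z * gen v = - (gen v * spin_val z)) ->
  \dim {:U} = \dim {:W}.
Proof.
move=> ndB gz zV; have [f fE] := spin_conj_linear g ndB.
have [_ [zz' _] _] := spinP z; have [_ [_ g'g] _] := spinP g.
apply: (@block_swap_dim _ U W f) => [x fx0|x].
  apply: (cgen_inj ndB); rewrite linear0; have := fE x; rewrite fx0 linear0.
  move/(congr1 (fun y => crev (spin_val g) * y * spin_val g)).
  by rewrite mulr0 mul0r !mulrA g'g mul1r -mulrA g'g mulr1.
apply: (cgen_inj ndB); rewrite linearN /= -fE.
rewrite -(cmap_cgen (@block_refl_isometry _ _ _ BU BW)).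
rewrite -fE !cmapM cmap_cgen cmap_rev -spin_theta_val gz spin_valM crevM.
rewrite !mulrA -(mulrA (spin_val g) _ (gen _)) zV mulrN !mulNr; congr (- _).
by rewrite !mulrA -(mulrA _ (spin_val z) (crev _)) zz' mulr1.
Qed.

End SpinBlockPair.

Theorem proposition6p6 (R : realType) (r s : nat)
    (U W : vectType R[i]) (BU : {symmetric U}) (BW : {symmetric W})
    (r_gt0 : (0 < r)%N) (s_gt0 : (0 < s)%N) (r_odd : odd r) (s_odd : odd s)
    (r_neq_s : r <> s)
    (dimU : \dim {:U} = r) (dimW : \dim {:W} = s)
    (BU_nondeg : nondegenerate BU) (BW_nondeg : nondegenerate BW) :
  pleasant (spin_theta BU BW) (fixed_subgroup (spin_theta BU BW)).
Proof.
move=> g [z zZ gz].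
have [sU sUB] := orthonormal_basis_exists BU_nondeg.
have [sW sWB] := orthonormal_basis_exists BW_nondeg.
have sEB := block_basis sUB sWB; set sE := block_seq sU sW in sEB.
have size_sU : size sU = r by rewrite -dimU; apply: orthonormal_basis_size sUB.
have size_sW : size sW = s by rewrite -dimW; apply: orthonormal_basis_size sWB.
have size_sE : size sE = (r + s)%N.
  by rewrite size_cat !size_map size_sU size_sW.
have sE_even : ~~ odd (size sE) by rewrite size_sE oddD r_odd s_odd.
have sE3 : (2 < size sE)%N.
  rewrite size_sE; move: r_odd s_odd r_neq_s.
  case: (r) => [|[|m]] //; case: (s) => [|[|n]] // _ _ _; rewrite ?addn1 //.
  by rewrite !addnS.
have [c [[->|->] zV]] := center_vectors sEB sE3 zZ; last first.
  case: r_neq_s; rewrite -dimU -dimW.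
  apply: (anticommuting_twist_swaps (orthonormal_basis_nondegenerate sEB) gz).
  by move=> v; rewrite zV scaleN1r.
have [z_even [zz' _] _] := spinP z.
have [|a za] := even_center_scalar sEB z_even.
  by move=> v; rewrite zV scale1r.
have : a ^+ 2 == 1.
  move: zz'; rewrite za crev_alg mulr_algl scalerA -expr2 => /eqP.
  rewrite -[X in _ == X]scale1r -subr_eq0 -scalerBl clifford_alg_eq0.
  by rewrite subr_eq0.
rewrite sqrf_eq1 => /orP[] /eqP a1; rewrite {a}a1 in za.
  exists g, 1%g; split.
  - rewrite /fixed_subgroup /= gz; apply: spin_val_inj.
    by rewrite spin_valM za scale1r mulr1.
  - by move=> x; apply: spin_val_inj; rewrite !spin_valM mul1r mulr1.
  - by rewrite mulg1.
(* Here z = -1: correct g by w, the product of an orthonormal basis. *)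
have w_spin : is_spin (cprod (orthosum BU BW) sE).
  by apply: is_spin_cprod => // e es; apply: orthonormal_seq_unit es; case: sEB.
pose w : spin (orthosum BU BW) := Spin (introT (asboolP _) w_spin).
have wZ : group_center w.
  move=> x; apply: spin_val_inj; have [x_even _ _] := spinP x.
  rewrite !spin_valM -[in RHS]x_even.
  by apply: anticommute_with_vectors => v; apply: cprod_basis_vector.
have theta_w : spin_val (spin_theta BU BW w) = - spin_val w.
  rewrite spin_theta_val theta_block_cprod size_sW -signr_odd s_odd.
  by rewrite expr1 scaleN1r.
exists (g * w^-1)%g, w; split=> //; last by rewrite mulgVK.
change (spin_theta BU BW (g * w^-1) = g * w^-1)%g.
apply: (mulIg w); rewrite mulgVK; apply: spin_val_inj; rewrite spin_valM.
have := congr1 (@spin_val _ _ _) (spin_thetaM (g * w^-1)%g w).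
by rewrite mulgVK gz !spin_valM theta_w za scaleN1r !mulrN mulr1 => /oppr_inj.
Qed.
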